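(* The set $\mathcal{U}_\infty$ contains an open neighborhood of the real interval $[0,e)$.
   Context: For $\Lambda\in\mathbb{C}$, $n\ge1$ and $s_1,\dots,s_n\ge0$ with $\sum s_i\le1$, let $E_{\Lambda,(s_1,\dots,s_n)}(Z_1,\dots,Z_n)=\Lambda e^{-s_1Z_1-\cdots-s_nZ_n}$. Let $G_\Lambda$ be the smallest class of functions $\mathbb{C}\to\mathbb{C}$ containing the identity and such that for every $k\ge1$, every $(s_1,\dots,s_k)\in\mathbb{R}_{\ge0}^k$ with $\sum s_m\le1$ and every $g_1,\dots,g_k\in G_\Lambda$, the map $Z\mapsto E_{\Lambda,(s_1,\dots,s_k)}(g_1(Z),\dots,g_k(Z))$ is in $G_\Lambda$. Let $V_\Lambda=\{g(0):g\in G_\Lambda\}$, $\mathcal{V}_\infty=\{\Lambda: V_\Lambda\text{ bounded}\}$ and $\mathcal{U}_\infty$ the interior of $\mathcal{V}_\infty$. *)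

(* Defs.v *)
From Stdlib Require Import Reals.
From Coquelicot Require Import Coquelicot.

Open Scope R_scope.

(* Coquelicot has no complex exponential: e^(x+iy) = e^x (cos y + i sin y). *)
Definition Cexp (z : C) : C :=
  Cmult (RtoC (exp (Re z))) (cos (Im z), sin (Im z)).

(* A tuple (s_1, ..., s_n) is given by a function on nat, of which only the
   values at 1, ..., n are relevant. *)
Definition admissible (n : nat) (s : nat -> R) : Prop :=
  (forall m : nat, (1 <= m <= n)%nat -> 0 <= s m) /\ sum_n_m s 1 n <= 1.

Definition E (Lambda : C) (n : nat) (s : nat -> R) (Z : nat -> C) : C :=
  Cmult Lambda
    (Cexp (Copp (sum_n_m (fun m : nat => Cmult (RtoC (s m)) (Z m)) 1 n))).

Inductive G (Lambda : C) : (C -> C) -> Prop :=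
| G_id : G Lambda (fun Z : C => Z)
| G_E (k : nat) (s : nat -> R) (g : nat -> C -> C) :
    (1 <= k)%nat ->
    admissible k s ->
    (forall m : nat, (1 <= m <= k)%nat -> G Lambda (g m)) ->
    G Lambda (fun Z : C => E Lambda k s (fun m : nat => g m Z)).

Definition V (Lambda : C) (v : C) : Prop :=
  exists g : C -> C, G Lambda g /\ v = g (RtoC 0).

Definition Cbounded (A : C -> Prop) : Prop :=
  exists M : R, forall z : C, A z -> Cmod z <= M.

Definition Cinterior (A : C -> Prop) (z : C) : Prop := locally z A.

Definition V_infty (Lambda : C) : Prop := Cbounded (V Lambda).

Definition U_infty : C -> Prop := Cinterior V_infty.

(* Main.v *)
Require Import Defs.
From Stdlib Require Import Reals Lra Lia.
From Coquelicot Require Import Coquelicot.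

(** Boundedness of [V_Lambda] follows from a bounded convex set [K] containing
    [0] with [Lambda e^(-K)] inside [K].  For [Lambda] near a real
    [l] in [[0,e)] take for [K] the thin trapezoid [-1/2 <= x <= 10],
    [|y| <= d (1 + x)].  To first order in [y], the map
    [f(x + iy) = l e^(-x-iy)] multiplies the height by [l e^(-x)], so
    invariance amounts to [f(x) (1 + x) < 1 + f(x)], that is to [l x < e^x],
    which holds for all [x] exactly because [l < e].  The strict inequality
    leaves room for the second order terms and for perturbing [l]. *)

(** * Stability of the trapezoid under admissible sums *)

Lemma sum_n_m_le_loc (a b : nat -> R) (n m : nat) :
  (forall k : nat, (n <= k <= m)%nat -> a k <= b k) ->
  sum_n_m a n m <= sum_n_m b n m.
Proof.
  intros Hab.
  (* The maximum agrees with [b] on the range and dominates [a] at every index, as [sum_n_m_le]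
     demands. *)
  rewrite (sum_n_m_ext_loc b (fun k => Rmax (a k) (b k))).
  - apply sum_n_m_le; intros k; apply Rmax_l.
  - intros k Hk; symmetry; apply Rmax_right, Hab, Hk.
Qed.

(** Real linear functionals cut out half-planes; the trapezoid is an intersection of four of
    them. *)
Definition Clin (a b : R) (z : C) : R := a * Re z + b * Im z.

Lemma Clin_sum_n_m (a b : R) (u : nat -> C) (n m : nat) :
  Clin a b (sum_n_m u n m) = sum_n_m (fun k => Clin a b (u k)) n m.
Proof.
  destruct (Nat.le_gt_cases n m) as [Hnm | Hnm].
  - induction Hnm as [| m Hnm IH].
    + now rewrite !sum_n_n.
    + rewrite !sum_n_Sm by lia.
      rewrite <- IH.
      unfold Clin, plus, Re, Im; simpl; ring.
  - rewrite !sum_n_m_zero by lia.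
    unfold Clin, zero, Re, Im; simpl; ring.
Qed.

(** Weights of total less than 1 leave the missing mass at the origin, which [0 <= c] places in the
    half-plane. *)
Lemma Clin_admissible_le (a b c : R) (k : nat) (s : nat -> R) (Z : nat -> C) :
  0 <= c -> admissible k s ->
  (forall m : nat, (1 <= m <= k)%nat -> Clin a b (Z m) <= c) ->
  Clin a b (sum_n_m (fun m : nat => Cmult (RtoC (s m)) (Z m)) 1 k) <= c.
Proof.
  intros Hc [Hs Hs1] HZ.
  rewrite Clin_sum_n_m.
  apply Rle_trans with (sum_n_m (fun m => mult c (s m)) 1 k).
  - apply sum_n_m_le_loc; intros m Hm.
    replace (Clin a b (Cmult (RtoC (s m)) (Z m))) with (Clin a b (Z m) * s m)
      by (unfold Clin, Re, Im; simpl; ring).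
    apply Rmult_le_compat_r; auto.
  - rewrite sum_n_m_mult_l.
    replace c with (c * 1) at 2 by ring.
    now apply Rmult_le_compat_l.
Qed.

Definition trapezoid (d : R) (z : C) : Prop :=
  - (1 / 2) <= Re z <= 10 /\ Rabs (Im z) <= d * (1 + Re z).

Lemma trapezoid_admissible (d : R) (k : nat) (s : nat -> R) (Z : nat -> C) :
  0 <= d -> admissible k s ->
  (forall m : nat, (1 <= m <= k)%nat -> trapezoid d (Z m)) ->
  trapezoid d (sum_n_m (fun m : nat => Cmult (RtoC (s m)) (Z m)) 1 k).
Proof.
  intros Hd Hs HZ.
  assert (HL := fun a b c Hc H => Clin_admissible_le a b c k s Z Hc Hs H).
  set (w := sum_n_m _ 1 k) in *.
  assert (H1 : Clin 1 0 w <= 10).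
  { apply HL; [lra |]; intros m Hm.
    destruct (HZ m Hm) as [H _]; unfold Clin; lra. }
  assert (H2 : Clin (-1) 0 w <= 1 / 2).
  { apply HL; [lra |]; intros m Hm.
    destruct (HZ m Hm) as [H _]; unfold Clin; lra. }
  assert (H3 : Clin (- d) 1 w <= d).
  { apply HL; [lra |]; intros m Hm.
    destruct (HZ m Hm) as [_ H]; apply Rabs_le_between in H; unfold Clin; lra. }
  assert (H4 : Clin (- d) (-1) w <= d).
  { apply HL; [lra |]; intros m Hm.
    destruct (HZ m Hm) as [_ H]; apply Rabs_le_between in H; unfold Clin; lra. }
  unfold Clin in *.
  split; [lra | apply Rabs_le_between; lra].
Qed.

(** * Elementary bounds on sine, cosine and the exponential *)

Lemma Rabs_sin_le (y : R) : Rabs (sin y) <= Rabs y.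
Proof.
  assert (Hpos : forall t, 0 < t -> Rabs (sin t) <= t).
  { intros t Ht.
    destruct (Rle_lt_dec t 1) as [Ht1 | Ht1].
    - assert (H := PI2_1).
      rewrite Rabs_pos_eq.
      + left; now apply sin_lt_x.
      + apply sin_ge_0; lra.
    - assert (H := SIN_bound t); apply Rabs_le; lra. }
  destruct (Rtotal_order y 0) as [Hy | [-> | Hy]].
  - rewrite <- (Rabs_Ropp (sin y)), <- sin_neg, (Rabs_left y) by lra.
    apply Hpos; lra.
  - rewrite sin_0; lra.
  - rewrite (Rabs_pos_eq y) by lra; now apply Hpos.
Qed.

Lemma cos_ge_quadratic (y : R) : 1 - y ^ 2 / 2 <= cos y.
Proof.
  replace y with (2 * (y / 2)) at 2 by field.
  rewrite cos_2a_sin.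
  assert (H := Rsqr_le_abs_1 _ _ (Rabs_sin_le (y / 2))).
  unfold Rsqr in H.
  nra.
Qed.

(** The line on the left is the tangent at 1 to the convex function [exp]. *)
Lemma exp_ge_e_mult (x : R) : exp 1 * x <= exp x.
Proof.
  replace x with (1 + (x - 1)) at 2 by ring.
  rewrite exp_plus.
  assert (H := exp_ineq1_le (x - 1)).
  assert (H1 := exp_pos 1).
  nra.
Qed.

(** A uniform margin in [l * x < exp x]. For [x <= 0] the bound [1 + x <= exp x] suffices. For
    [x > 0] and [r = l / exp 1], the tangent bound leaves [(1 - r) * exp x], at least [1 - r]. *)
Lemma exp_sub_linear_lower (l x : R) :
  0 <= l < exp 1 -> - (1 / 2) <= x ->
  Rmin (1 / 2) (1 - l / exp 1) <= exp x - l * x.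
Proof.
  intros Hl Hx.
  assert (He := exp_ineq1_le x).
  assert (He1 := exp_pos 1).
  destruct (Rle_lt_dec x 0) as [Hx0 | Hx0].
  - apply Rle_trans with (1 := Rmin_l _ _); nra.
  - apply Rle_trans with (1 := Rmin_r _ _).
    assert (H := exp_ge_e_mult x).
    set (r := l / exp 1).
    assert (Hr : l = r * exp 1) by (unfold r; field; lra).
    assert (Hr01 : 0 <= r < 1) by (split; nra).
    rewrite Hr.
    nra.
Qed.

(** * Invariance of the trapezoid *)

Lemma trapezoid_invariant (l m : R) (Lambda z : C) :
  0 <= l <= 3 -> 0 < m <= 1 / 2 ->
  (forall x, - (1 / 2) <= x -> m <= exp x - l * x) ->
  Rabs (Re Lambda - l) <= m ^ 2 / 100 -> Rabs (Im Lambda) <= m ^ 2 / 100 ->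
  trapezoid (m / 20) z ->
  trapezoid (m / 20) (Cmult Lambda (Cexp (Copp z))).
Proof.
  intros Hl Hm Hexp Hp Hq [Hx Hy].
  destruct Lambda as [p q], z as [x y].
  unfold trapezoid, Cexp, Cmult, Copp, RtoC, Re, Im in *; simpl fst in *; simpl snd in *.
  rewrite cos_neg, sin_neg, exp_Ropp.
  specialize (Hexp x (proj1 Hx)).
  assert (HX := exp_ineq1_le x).
  set (X := exp x) in *.
  assert (HX2 : 1 / 2 <= X) by lra.
  assert (HXi : 0 < / X <= 2).
  { split; [apply Rinv_0_lt_compat; lra |].
    replace 2 with (/ (1 / 2)) by field.
    apply Rinv_le_contravar; lra. }
  assert (Hc := cos_ge_quadratic y).
  assert (Hc1 := COS_bound y).
  assert (Hs1 := SIN_bound y).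
  assert (Hs := Rabs_sin_le y).
  set (c := cos y) in *.
  set (t := sin y) in *.
  (* The perturbation [h] is the slope [m / 20] times [m / 5], so dividing by the slope leaves only
     a fifth of the margin [m]. *)
  set (h := m ^ 2 / 100) in *.
  assert (Hh : 0 < h <= 1 / 400) by (unfold h; split; nra).
  assert (Hyb : Rabs y <= m / 20 * 11) by nra.
  assert (Hy2 : y ^ 2 <= (m / 20 * 11) ^ 2).
  { rewrite <- (pow2_abs y); apply pow_incr; split; [apply Rabs_pos | exact Hyb]. }
  (* The image point is [(A + i B) / X]. *)
  set (A := p * c + q * t).
  set (B := q * c - p * t).
  assert (Hre : p * (/ X * c - 0 * - t) - q * (/ X * - t + 0 * c) = / X * A)
    by (unfold A; ring).
  assert (Him : p * (/ X * - t + 0 * c) + q * (/ X * c - 0 * - t) = / X * B)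
    by (unfold B; ring).
  rewrite Hre, Him.
  assert (Hp' := Hp); apply Rabs_le_between in Hp'.
  assert (Hq' := Hq); apply Rabs_le_between in Hq'.
  assert (Ht1 : Rabs t <= 1) by (apply Rabs_le; lra).
  assert (Hca : Rabs c <= 1) by (apply Rabs_le; lra).
  assert (Hpc : Rabs ((p - l) * c) <= h).
  { rewrite Rabs_mult; assert (H := Rabs_pos (p - l)); assert (H' := Rabs_pos c); nra. }
  assert (Hqt : Rabs (q * t) <= h).
  { rewrite Rabs_mult; assert (H := Rabs_pos q); assert (H' := Rabs_pos t); nra. }
  apply Rabs_le_between in Hpc; apply Rabs_le_between in Hqt.
  assert (HAlow : l * (1 - y ^ 2 / 2) - 2 * h <= A).
  { unfold A.
    assert (l * (1 - y ^ 2 / 2) <= l * c) by (apply Rmult_le_compat_l; lra).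
    lra. }
  assert (HAup : A <= l + 2 * h).
  { unfold A.
    assert (l * c <= l * 1) by (apply Rmult_le_compat_l; lra).
    lra. }
  assert (HB : Rabs B <= h + (l + h) * Rabs y).
  { unfold B, Rminus.
    apply Rle_trans with (1 := Rabs_triang _ _).
    rewrite Rabs_Ropp, !Rabs_mult.
    assert (Hpa : Rabs p <= l + h) by (apply Rabs_le; lra).
    apply Rplus_le_compat.
    - assert (H := Rabs_pos q); assert (H' := Rabs_pos c); nra.
    - apply Rmult_le_compat; try apply Rabs_pos; assumption. }
  assert (Hlow0 : 0 <= l * (1 - y ^ 2 / 2)) by (apply Rmult_le_pos; nra).
  (* The slanted sides for the image point, with the denominator [X] cleared. *)
  assert (Hkey : Rabs B <= m / 20 * (X + A)).
  { apply Rle_trans with (1 := HB).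
    apply Rle_trans with (m / 20 * (X + (l * (1 - y ^ 2 / 2) - 2 * h)));
      [| apply Rmult_le_compat_l; lra].
    apply Rle_trans with (h + (l + h) * (m / 20 * (1 + x))).
    { apply Rplus_le_compat_l, Rmult_le_compat_l; [lra | exact Hy]. }
    assert (Hl2 : l * y ^ 2 <= 3 * (m / 20 * 11) ^ 2)
      by (apply Rmult_le_compat; try lra; apply pow2_ge_0).
    assert (Hhm : h <= m / 200) by (unfold h; nra).
    assert (Hhx : h * (1 + x) <= h * 11) by (apply Rmult_le_compat_l; lra).
    assert (Hm2 : m ^ 2 <= m / 2) by nra.
    (* The margin [m] from [Hexp] absorbs [m / 5], [13 * h] and the second order term
       [l * y ^ 2 / 2], which total less than [m / 2]. *)
    assert (Hfin : m / 5 + l * (1 + x) + h * 11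
                   <= X + (l * (1 - y ^ 2 / 2) - 2 * h)) by nra.
    replace h with (m / 20 * (m / 5)) at 1 by (unfold h; field).
    replace (m / 20 * (m / 5) + (l + h) * (m / 20 * (1 + x)))
      with (m / 20 * (m / 5 + l * (1 + x) + h * (1 + x))) by ring.
    apply Rmult_le_compat_l; lra. }
  split.
  (* As [/ X <= 2], the real part lies between -0.01 and 6.01, well within the vertical sides. *)
  - split; nra.
  - rewrite Rabs_mult, (Rabs_pos_eq (/ X)) by lra.
    replace (m / 20 * (1 + / X * A)) with (/ X * (m / 20 * (X + A)))
      by (field; lra).
    apply Rmult_le_compat_l; lra.
Qed.

(** * From invariance to boundedness near the real segment *)

Lemma V_trapezoid (d : R) (Lambda : C) :
  0 <= d ->
  (forall z, trapezoid d z -> trapezoid d (Cmult Lambda (Cexp (Copp z)))) ->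
  forall v, V Lambda v -> trapezoid d v.
Proof.
  intros Hd Hinv v [g [Hg ->]].
  induction Hg as [| k s g Hk Hs _ IH].
  - split; unfold RtoC, Re, Im; simpl; [lra | rewrite Rabs_R0; lra].
  - now apply Hinv, trapezoid_admissible.
Qed.

Lemma trapezoid_bounded (d : R) : 0 <= d -> Cbounded (trapezoid d).
Proof.
  intros Hd; exists (10 + d * 11); intros [x y] [Hx Hy].
  unfold Re, Im in *; simpl in *.
  replace (x, y) with (Cplus (RtoC x) (Cmult Ci (RtoC y)))
    by (unfold Cplus, Cmult, RtoC, Ci; simpl; f_equal; ring).
  apply Rle_trans with (1 := Cmod_triangle _ _).
  rewrite Cmod_mult, !Cmod_R, Cmod_Ci, Rmult_1_l.
  apply Rplus_le_compat; [apply Rabs_le; lra | nra].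
Qed.

Lemma U_infty_real (l : R) : 0 <= l < exp 1 -> U_infty (RtoC l).
Proof.
  intros Hl.
  set (m := Rmin (1 / 2) (1 - l / exp 1)).
  assert (He := exp_le_3).
  assert (He0 := exp_pos 1).
  assert (Hm : 0 < m <= 1 / 2).
  { split; [| apply Rmin_l].
    (* Here [l < exp 1] makes the margin positive. *)
    apply Rmin_glb_lt; [lra |].
    apply Rlt_0_minus, Rlt_div_l; lra. }
  assert (Hh : 0 < m ^ 2 / 100) by nra.
  (* Balls of [C] are squares, so membership bounds the real and imaginary parts separately. *)
  exists (mkposreal _ Hh); intros Lambda [Hp Hq].
  change (Rabs (Re Lambda - l) < m ^ 2 / 100) in Hp.
  change (Rabs (Im Lambda - 0) < m ^ 2 / 100) in Hq.
  rewrite Rminus_0_r in Hq.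
  destruct (trapezoid_bounded (m / 20)) as [M HM]; [lra |].
  exists M; intros v Hv; apply HM; revert v Hv.
  apply V_trapezoid; [lra |].
  intros z; apply trapezoid_invariant with l; try lra.
  intros x Hx; now apply exp_sub_linear_lower.
Qed.

Theorem theorem1p8 :
  exists O : C -> Prop,
    open O /\
    (forall x : R, 0 <= x < exp 1 -> O (RtoC x)) /\
    (forall Lambda : C, O Lambda -> U_infty Lambda).
Proof.
  exists U_infty; split; [| split].
  - intros z Hz; exact (locally_locally z V_infty Hz).
  - exact U_infty_real.
  - trivial.
Qed.
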